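(* Let $\alpha,\beta,\gamma,\delta\in\mathbb{R}$, and set $\sigma(x)=\alpha x+\beta$ and $b(x)=\gamma x+\delta$ for all $x\in\mathbb{R}$. Define operators $A^*$ and $L^*$ by $$A^*\phi=-\partial(\sigma\phi),\qquad L^*\phi=\tfrac12\,\partial^2(\sigma^2\phi)-\partial(b\phi).$$ Then for every $p\in\mathbb{R}$ there is a constant $C=C(\sigma,b,p)>0$ such that $$2\langle \phi, L^*\phi\rangle_p+\|A^*\phi\|_p^2\le C\,\|\phi\|_p^2\qquad\text{for all }\phi\in\mathcal{S}(\mathbb{R}).$$
   Context: $\mathcal{S}(\mathbb{R})$ is the Schwartz space of real-valued rapidly decreasing smooth functions on $\mathbb{R}$, and $\partial$ denotes differentiation. The Hermite functions are $h_k(t)=(2^k k!\sqrt{\pi})^{-1/2}e^{-t^2/2}H_k(t)$, $k\ge 0$, where $H_k$ are the (physicists') Hermite polynomials; they form an orthonormal basis of $L^2(\mathbb{R},dx)$, whose inner product is denoted $\langle\cdot,\cdot\rangle_0$. For $p\in\mathbb{R}$ and $f,g\in\mathcal{S}(\mathbb{R})$, the Hermite-Sobolev inner product is $$\langle f,g\rangle_p=\sum_{k=0}^\infty(2k+1)^{2p}\langle f,h_k\rangle_0\langle g,h_k\rangle_0,$$ and $\|f\|_p=\langle f,f\rangle_p^{1/2}$. For $\phi\in\mathcal{S}(\mathbb{R})$, both $A^*\phi$ and $L^*\phi$ are in $\mathcal{S}(\mathbb{R})$. *)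

(* Defs.v *)
From mathcomp Require Import all_boot all_order all_algebra.
From mathcomp Require Import all_classical all_reals all_analysis.
From mathcomp Require Import ring.

Set Implicit Arguments.
Unset Strict Implicit.
Unset Printing Implicit Defensive.

Import Order.TTheory GRing.Theory Num.Theory numFieldNormedType.Exports.

Local Open Scope classical_set_scope.
Local Open Scope ring_scope.

Definition smooth (R : realType) (f : R -> R) : Prop :=
  forall (n : nat) (x : R), derivable f^`(n)%classic x 1.

Definition schwartz (R : realType) (f : R -> R) : Prop :=
  smooth f /\ forall m n : nat, exists M : R, forall x : R,
    `|x ^+ m * f^`(n)%classic x| <= M.

(* Physicists' normalisation, H_(j+1) = 2 X H_j - H_j', equivalent to the
   Rodrigues formula proved below. *)
Fixpoint hermite_poly (R : realType) (k : nat) : {poly R} :=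
  if k is j.+1 then 'X *+ 2 * hermite_poly R j - (hermite_poly R j)^`()
  else 1.

Lemma hermite_poly_Rodrigues (R : realType) (k : nat) (x : R) :
  (hermite_poly R k).[x] =
  (-1) ^+ k * expR (x ^+ 2) * (fun y : R => expR (- y ^+ 2))^`(k)%classic x.
Proof.
suff -> : (fun y : R => expR (- y ^+ 2))^`(k)%classic =
    (fun y => (-1) ^+ k * (hermite_poly R k).[y] * expR (- y ^+ 2)).
  rewrite -mulrA [expR (x ^+ 2) * _]mulrC -!mulrA -expRD addNr expR0 mulr1.
  by rewrite mulrA -exprMn mulrNN mulr1 expr1n mul1r.
elim: k => [|k IH]; first by apply/funext => y; rewrite /= hornerC expr0 !mul1r.
rewrite derive1nS IH; apply/funext => y; rewrite derive1E.
rewrite (_ : (fun y => _) = (fun y => (-1) ^+ k * (hermite_poly R k).[y])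
  \* (expR \o (fun y : R => - y ^+ 2)))//.
rewrite derive_val /=.
rewrite hornerD hornerN hornerM hornerMn hornerX [_ ^+ k.+1]exprS.
set h := (hermite_poly R k).[y]; set d := _^`().[y].
set e := expR _; set s := (-1) ^+ k.
change (s * h * (e * - (y * 1 + y * 1)) + e * (s * d) =
  -1 * s * (y *+ 2 * h - d) * e :> R).
by ring.
Qed.

Definition hermite_fun (R : realType) (k : nat) (t : R) : R :=
  (Num.sqrt (2 ^+ k * k`!%:R * Num.sqrt pi))^-1 *
  expR (- (t ^+ 2 / 2)) * (hermite_poly R k).[t].

(* Integrals and series below are total operators; on Schwartz functions the
   integrand is Lebesgue integrable and the series converges, so no default
   value is involved. *)
Definition L2_inner (R : realType) (f g : R -> R) : R :=
  (\int[@lebesgue_measure R]_x (f x * g x))%R.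

Definition hs_inner (R : realType) (p : R) (f g : R -> R) : R :=
  limn (series (fun k => (2 * k + 1)%:R `^ (2 * p) *
    L2_inner f (hermite_fun k) * L2_inner g (hermite_fun k))).

Definition hs_norm (R : realType) (p : R) (f : R -> R) : R :=
  Num.sqrt (hs_inner p f f).

Definition A_adj (R : realType) (sigma phi : R -> R) : R -> R :=
  fun x => - (fun y => sigma y * phi y)^`()%classic x.

Definition L_adj (R : realType) (sigma b phi : R -> R) : R -> R :=
  fun x => 2^-1 * (fun y => sigma y ^+ 2 * phi y)^`(2)%classic x
           - (fun y => b y * phi y)^`()%classic x.

(* Main.v *)
Require Import Defs.
From mathcomp Require Import all_boot all_order all_algebra.
From mathcomp Require Import all_classical all_reals all_analysis.
From mathcomp Require Import measurable_realfun.
From mathcomp Require Import ring lra zify.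

Set Implicit Arguments.
Unset Strict Implicit.
Unset Printing Implicit Defensive.

Import Order.TTheory GRing.Theory Num.Theory numFieldNormedType.Exports.

Local Open Scope classical_set_scope.
Local Open Scope ring_scope.

(** Everything happens on the sequence a k = <phi, h_k> of Hermite coefficients.
Integration by parts turns A* into an explicit band operator A on sequences,
and L* into (1/2) A A - (alpha/2) A + A', where A' is the operator A built from
b instead of sigma.  Write w k = (2k+1)^(2p) and <a, c>_w for the sum of
w k * a k * c k.  As the coefficients of a Schwartz function decrease rapidly,
all sums may be split and re-indexed, and the claim becomes a bound on
<a, AAa>_w + <Aa, Aa>_w, on <a, Aa>_w and on <a, A'a>_w by C <a, a>_w.

The operator is A = G - alpha/2, where G moves indices by 1 or 2 with
coefficients u that grow at most linearly in k (like sqrt k, resp. k), and is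
antisymmetric for w = 1.  Hence for general w only differences of the weight
survive in <a, Gc>_w + <Ga, c>_w: its coefficients are
t k = (w (k+j) - w k) * u (k+j), and these are O(w k), because differencing a
power gains a factor 1/k (tame_skew, symbol0_diff).  Taking c = a bounds
<a, Ga>_w.  Taking c = Ga, the second-order quantity
<a, GGa>_w + <Ga, Ga>_w becomes a sum with coefficients t k against a and Ga,
where the growth of G has to be absorbed once more.  Because G is
antisymmetric up to shifts, the dangerous products t * u occur only in
differences such as t (k+i) * u (k+i+j) - t k * u (k+i), and these are O(w k)
since t and u behave like symbols of order 0 (relative to w) and 1
(tame_cross).  This needs second differences of w, which the mean value
theorem supplies (symbol_weight_pow).

On the analytic side, the three-term relations for x h_k and h_k' give the
matrix of A (hcoef_A_adj).  Rapid decrease of the coefficients follows because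
h_k is an eigenfunction of x^2 - d^2/dx^2 with eigenvalue 2k+1
(hcoef_oscillator, rapid_hcoef). *)

(** * Rapidly decreasing sequences *)

Section RapidSequences.
Context {R : realType}.
Implicit Types (a b c f g : nat -> R).

Definition rapid a := forall N : nat, exists M : R, forall k : nat,
  `|a k| * k.+1%:R ^+ N <= M.

Definition tempered f := exists (C : R) (N : nat), forall k : nat,
  `|f k| <= C * k.+1%:R ^+ N.

Lemma rapid_const (a : nat -> R) (N : nat) :
  rapid a -> exists2 M : R, 0 <= M & forall k, `|a k| * k.+1%:R ^+ N <= M.
Proof.
move=> /(_ N)[M HM]; exists M => //.
by apply: le_trans (HM 0%N); rewrite mulr_ge0// exprn_ge0.
Qed.

Lemma tempered_const f : tempered f -> exists (C : R) (N : nat), 0 <= C /\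
  forall k : nat, `|f k| <= C * k.+1%:R ^+ N.
Proof.
move=> [C [N H]]; exists C, N; split => //.
by have := le_trans (normr_ge0 _) (H 0%N); rewrite expr1n mulr1.
Qed.

Lemma rapid_le a b : (forall k, `|a k| <= `|b k|) -> rapid b -> rapid a.
Proof.
move=> ab rb N; have [M HM] := rb N; exists M => k.
by apply: le_trans (HM k); rewrite ler_wpM2r// exprn_ge0.
Qed.

Lemma rapidD a b : rapid a -> rapid b -> rapid (fun k => a k + b k).
Proof.
move=> ra rb N; have [M HM] := ra N; have [M' HM'] := rb N.
exists (M + M') => k; apply: le_trans (lerD (HM k) (HM' k)).
by rewrite -mulrDl ler_wpM2r ?exprn_ge0// ler_normD.
Qed.

Lemma rapidN a : rapid a -> rapid (fun k => - a k).
Proof. by apply: rapid_le => k; rewrite normrN. Qed.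

Lemma rapidB a b : rapid a -> rapid b -> rapid (fun k => a k - b k).
Proof. by move=> ra /rapidN; exact: rapidD. Qed.

Lemma rapidM_tempered f a : tempered f -> rapid a -> rapid (fun k => f k * a k).
Proof.
move=> /tempered_const[C [P [C0 HC]]] ra N.
have [M HM] := ra (P + N)%N; exists (C * M) => k.
apply: le_trans (ler_wpM2l C0 (HM k)).
rewrite normrM exprD [leRHS](_ : _ =
  (C * k.+1%:R ^+ P) * `|a k| * k.+1%:R ^+ N); last by ring.
by rewrite ler_wpM2r ?exprn_ge0// ler_wpM2r.
Qed.

Lemma tempered_cst (x : R) : tempered (fun=> x).
Proof. by exists `|x|, 0%N => k; rewrite expr0 mulr1. Qed.

Lemma temperedM f g : tempered f -> tempered g -> tempered (fun k => f k * g k).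
Proof.
move=> /tempered_const[C [P [C0 HC]]] /tempered_const[D [Q [D0 HD]]].
exists (C * D), (P + Q)%N => k; rewrite normrM.
apply: le_trans (ler_pM _ _ (HC k) (HD k)) _ => //.
by rewrite exprD le_eqVlt; apply/orP; left; apply/eqP; ring.
Qed.

Lemma tempered_shift j f : tempered f -> tempered (fun k => f (k + j)%N).
Proof.
move=> /tempered_const[C [P [C0 HC]]]; exists (C * j.+1%:R ^+ P), P => k.
apply: le_trans (HC _) _; rewrite -mulrA ler_wpM2l// -exprMn -natrM.
by rewrite lerXn2r ?nnegrE ?ler0n// ler_nat; nia.
Qed.

Lemma rapid_tempered a : rapid a -> tempered a.
Proof.
by move=> /(_ 0%N)[M HM]; exists M, 0%N => k; have := HM k; rewrite expr0 !mulr1.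
Qed.

Lemma rapidM a b : rapid a -> rapid b -> rapid (fun k => a k * b k).
Proof. by move=> /rapid_tempered; exact: rapidM_tempered. Qed.

Lemma rapidZ x a : rapid a -> rapid (fun k => x * a k).
Proof. exact/rapidM_tempered/tempered_cst. Qed.

Lemma rapid_addn j a : rapid a -> rapid (fun k => a (k + j)%N).
Proof.
move=> ra N; have [M HM] := ra N; exists M => k.
apply: le_trans (HM (k + j)%N); rewrite ler_wpM2l//.
by rewrite lerXn2r ?nnegrE ?ler0n// ler_nat ltnS leq_addr.
Qed.

Lemma rapid_subn j a : rapid a -> rapid (fun k => a (k - j)%N).
Proof.
move=> ra N; have [M HM] := ra N; exists (j.+1%:R ^+ N * M) => k.
apply: le_trans (ler_wpM2l _ (HM (k - j)%N)); last exact: exprn_ge0.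
rewrite mulrCA -exprMn ler_wpM2l//.
by rewrite lerXn2r ?nnegrE ?mulr_ge0 ?ler0n// -natrM ler_nat; nia.
Qed.

(** The comparison series for quadratic decay, chosen so that its partial sums
are explicit: 1/((k+1)(k+2)) = 1/(k+1) - 1/(k+2). *)
Lemma is_cvg_series_telescoping (M : R) :
  cvgn (series (fun k => M * (k.+1%:R * k.+2%:R)^-1)).
Proof.
rewrite (_ : (fun k => _) = M *: telescope (fun k : nat => - k.+1%:R^-1)).
  apply: is_cvg_seriesZ; rewrite telescopeK; apply: is_cvgB; last exact: is_cvg_cst.
  by apply: is_cvgN; apply/cvg_ex; exists 0; exact: cvg_harmonic.
apply/funext => k; rewrite /telescope -[RHS]/(M * (_ - _)).
congr (_ * _); rewrite opprK -[k.+2%:R]nat1r.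
have : k.+1%:R != 0 :> R by rewrite pnatr_eq0.
have : (1 + k.+1%:R) != 0 :> R by rewrite nat1r pnatr_eq0.
by move: (k.+1%:R) => x x0 x1; field; apply/andP.
Qed.

Lemma rapid_normed_cvg a : rapid a -> cvgn [normed series a].
Proof.
move=> ra; have [M M0 HM] := rapid_const 2 ra.
apply: (@series_le_cvg _ _ (fun k => (M * 2) * (k.+1%:R * k.+2%:R)^-1)).
- by move=> n; exact: normr_ge0.
- by move=> n; rewrite !mulr_ge0 ?invr_ge0 ?mulr_ge0 ?ler0n.
- move=> k /=; rewrite ler_pdivlMr ?mulr_gt0 ?ltr0n//.
  have : k.+2%:R <= 2 * k.+1%:R :> R by rewrite -natrM ler_nat; lia.
  have : 0 <= k.+1%:R :> R by rewrite ler0n.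
  have := HM k; have := normr_ge0 (a k); rewrite expr2.
  move: (k.+1%:R : R) (k.+2%:R : R) (`|a k| : R) => x y z z0 zM x0 yx.
  have zx : z * (x * y) <= z * (x * (2 * x)) by apply: ler_wpM2l => //; exact: ler_wpM2l.
  by move: zM; lra.
- exact: is_cvg_series_telescoping.
Qed.

Lemma rapid_cvg a : rapid a -> cvgn (series a).
Proof. by move=> /rapid_normed_cvg; exact: normed_cvg. Qed.

Definition sums a : R := limn (series a).

Lemma sumsD a b : rapid a -> rapid b ->
  sums (fun k => a k + b k) = sums a + sums b.
Proof. by move=> ra rb; exact: (lim_seriesD (rapid_cvg ra) (rapid_cvg rb)). Qed.

Lemma sumsZ x a : rapid a -> sums (fun k => x * a k) = x * sums a.
Proof. by move=> ra; exact: (lim_seriesZ x (rapid_cvg ra)). Qed.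

Lemma sumsB a b : rapid a -> rapid b ->
  sums (fun k => a k - b k) = sums a - sums b.
Proof. by move=> ra rb; exact: (lim_seriesB (rapid_cvg ra) (rapid_cvg rb)). Qed.

Lemma ler_sums a b : rapid a -> rapid b -> (forall k, a k <= b k) ->
  sums a <= sums b.
Proof. by move=> /rapid_cvg ca /rapid_cvg cb; exact: lim_series_le. Qed.

Lemma sums_ge0 a : rapid a -> (forall k, 0 <= a k) -> 0 <= sums a.
Proof.
move=> ra a0; rewrite -[leLHS](mul0r (sums a)) -sumsZ//.
by apply: ler_sums => // [|k]; [exact: rapidZ|rewrite mul0r].
Qed.

Lemma rapid_norm a : rapid a -> rapid (fun k => `|a k|).
Proof. by apply: rapid_le => k; rewrite normr_id. Qed.

Lemma ler_norm_sums a : rapid a -> `|sums a| <= sums (fun k => `|a k|).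
Proof. by move=> /rapid_normed_cvg; exact: lim_series_norm. Qed.

Lemma sums_recl a : rapid a -> sums a = a 0%N + sums (fun k => a k.+1).
Proof.
move=> ra; have ca := rapid_cvg ra.
have ra1 : rapid (fun k => a k.+1).
  by have := rapid_addn 1 ra; under eq_fun do rewrite addn1.
have ca1 := rapid_cvg ra1.
rewrite /sums; apply/(cvg_lim (@Rhausdorff R)).
rewrite -cvg_shiftS /=.
rewrite (_ : (fun n => series a n.+1) = cst (a 0%N) \+ series (fun k => a k.+1)).
  by apply: cvgD => //; exact: cvg_cst.
by apply/funext => n; rewrite seriesEnat/= big_nat_recl// seriesEnat.
Qed.

Lemma sums_shift j a : rapid a ->
  sums a = \sum_(k < j) a k + sums (fun k => a (k + j)%N).
Proof.
move=> ra; elim: j => [|j IH].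
  by rewrite big_ord0 add0r; congr sums; apply/funext => k; rewrite addn0.
rewrite IH big_ord_recr/= -addrA; congr (_ + _).
rewrite sums_recl; last exact: rapid_addn.
by rewrite add0n; congr (_ + sums _); apply/funext => k; rewrite addSnnS.
Qed.

End RapidSequences.

(** * Difference estimates for weights and coefficients *)

Section SymbolEstimates.
Context {R : realType}.
Implicit Types (a b c t u w : nat -> R).

(** The discrete counterpart of a symbol estimate: each difference of w gains a
factor 1/k.  The steps i and j are arbitrary because the operators below move
indices by 1 and by 2. *)
Record symbol_weight w : Prop := SymbolWeight {
  weight_gt0 : forall k, 0 < w k;
  weight_tempered : tempered w;
  weight_le_addn : forall j, exists C : R, forall k, w k <= C * w (k + j)%N;
  weight_diff1 : forall j, exists C : R, forall k,
    `|w (k + j)%N - w k| * k.+1%:R <= C * w k;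
  weight_diff2 : forall i j, exists C : R, forall k,
    `|w (k + i + j)%N - w (k + i)%N - (w (k + j)%N - w k)| * k.+1%:R ^+ 2
      <= C * w k }.

(** Sequences behaving like a symbol of order 1, such as sqrt k and k. *)
Definition symbol1 u : Prop :=
  (exists C : R, forall k, `|u k| <= C * k.+1%:R) /\
  (forall i, exists C : R, forall k, `|u (k + i)%N - u k| <= C).

(** Sequences behaving like w times a symbol of order 0. *)
Definition symbol0 w t : Prop :=
  (exists C : R, forall k, `|t k| <= C * w k) /\
  (forall i, exists C : R, forall k, `|t (k + i)%N - t k| * k.+1%:R <= C * w k).

Lemma symbol1_tempered u : symbol1 u -> tempered u.
Proof. by move=> [[C HC] _]; exists C, 1%N => k; rewrite expr1. Qed.

Lemma symbol1_addn j u : symbol1 u -> symbol1 (fun k => u (k + j)%N).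
Proof.
move=> [[C HC] Hd]; split.
  exists (C * j.+1%:R) => k; apply: le_trans (HC _) _.
  have C0 : 0 <= C by have := le_trans (normr_ge0 _) (HC 0%N); rewrite mulr1.
  by rewrite -mulrA ler_wpM2l// -natrM ler_nat; nia.
by move=> i; have [D HD] := Hd i; exists D => k; rewrite addnAC.
Qed.

Lemma symbol1Z (x : R) u : symbol1 u -> symbol1 (fun k => x * u k).
Proof.
move=> [[C HC] Hd]; split.
  by exists (`|x| * C) => k; rewrite normrM -mulrA ler_wpM2l.
move=> i; have [D HD] := Hd i; exists (`|x| * D) => k.
by rewrite -mulrBr normrM ler_wpM2l.
Qed.

Lemma symbol0_tempered w t : symbol_weight w -> symbol0 w t -> tempered t.
Proof.
move=> [w0 /tempered_const[D [N [D0 HD]]] _ _ _] [[C HC] _].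
exists (`|C| * D), N => k; apply: le_trans (HC k) _.
apply: le_trans (ler_norm _) _; rewrite normrM -mulrA ler_wpM2l//.
Qed.

(** Differencing w lowers the order by one and multiplying by u restores it; the
second part is the discrete Leibniz rule, one term using the second difference
of w and the other the difference of u. *)
Lemma symbol0_diff w u j : symbol_weight w -> symbol1 u ->
  symbol0 w (fun k => (w (k + j)%N - w k) * u k).
Proof.
move=> [w0 _ _ d1 d2] [[C HC] Hd].
have C0 : 0 <= C by have := le_trans (normr_ge0 _) (HC 0%N); rewrite mulr1.
split.
  have [D HD] := d1 j; exists (D * C) => k; rewrite normrM.
  have kC := HC k; have kD := HD k.
  apply: (@le_trans _ _ (`|w (k + j)%N - w k| * (C * k.+1%:R))).
    by rewrite ler_wpM2l.
  by have := ler_wpM2l C0 kD; lra.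
move=> i; have [D HD] := d1 j; have [E HE] := d2 i j; have [B HB] := Hd i.
have [[K HK] _] := symbol1_addn i (conj (ex_intro _ C HC) Hd).
have K0 : 0 <= K by have := le_trans (normr_ge0 _) (HK 0%N); rewrite mulr1.
have B0 : 0 <= B by apply: le_trans (HB 0%N).
exists (E * K + D * B) => k.
have k0 : 0 <= k.+1%:R :> R by exact: ler0n.
set x2 := w (k + i + j)%N - w (k + i)%N - (w (k + j)%N - w k).
set x1 := w (k + j)%N - w k.
rewrite (_ : _ - _ = x2 * u (k + i)%N + x1 * (u (k + i)%N - u k)); last first.
  by rewrite /x2 /x1; ring.
apply: le_trans (ler_wpM2r k0 (ler_normD _ _)) _.
rewrite !normrM [leRHS]mulrDl mulrDl; apply: lerD.
  apply: (@le_trans _ _ (`|x2| * (K * k.+1%:R) * k.+1%:R)).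
    by rewrite ler_wpM2r// ler_wpM2l.
  have := ler_wpM2l K0 (HE k); rewrite -/x2 expr2.
  by lra.
apply: (@le_trans _ _ (`|x1| * B * k.+1%:R)).
  by rewrite ler_wpM2r// ler_wpM2l.
by have := ler_wpM2l B0 (HD k); rewrite -/x1; lra.
Qed.

End SymbolEstimates.

(** * Quadratic forms bounded by the weighted norm *)

Section TameFunctionals.
Context {R : realType}.
Variable w : nat -> R.
Hypothesis w_symbol : symbol_weight w.
Implicit Types (a b c t u : nat -> R) (F H V : (nat -> R) -> nat -> R).

Definition wnorm2 a : R := sums (fun k => w k * a k ^+ 2).

(** F a is the general term of a series depending quadratically on a, and the
constant is uniform in a.  Rapid decrease of F a is part of the notion so that
such series can be added and shifted. *)
Definition tame F : Prop := exists C : R, forall a, rapid a ->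
  rapid (F a) /\ `|sums (F a)| <= C * wnorm2 a.

Lemma rapid_wnorm2 a : rapid a -> rapid (fun k => w k * a k ^+ 2).
Proof.
move=> ra; apply: rapidM_tempered; first exact: weight_tempered.
by under eq_fun do rewrite expr2; exact: rapidM.
Qed.

Lemma wterm_ge0 a k : 0 <= w k * a k ^+ 2.
Proof. by rewrite mulr_ge0 ?sqr_ge0// ltW// weight_gt0. Qed.

Lemma wnorm2_ge0 a : rapid a -> 0 <= wnorm2 a.
Proof.
by move=> ra; apply: sums_ge0; [exact: rapid_wnorm2|exact: wterm_ge0].
Qed.

Lemma wnorm2_tail j a : rapid a ->
  sums (fun k => w (k + j)%N * a (k + j)%N ^+ 2) <= wnorm2 a.
Proof.
move=> ra; rewrite [leRHS](sums_shift j (rapid_wnorm2 ra)) lerDr.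
by apply: sumr_ge0 => k _; exact: wterm_ge0.
Qed.

Lemma wnorm2_entry a k : rapid a -> w k * a k ^+ 2 <= wnorm2 a.
Proof.
move=> ra; apply: le_trans (wnorm2_tail k ra).
have rs := rapid_addn k (rapid_wnorm2 ra).
rewrite (sums_shift 1 rs) big_ord1 add0n lerDl.
apply: sums_ge0 => [|l]; last exact: wterm_ge0.
exact: rapid_addn rs.
Qed.

Lemma eq_tame F H : (forall a k, F a k = H a k) -> tame H -> tame F.
Proof. by move=> FH; rewrite (_ : F = H)//; apply/funext => a; apply/funext. Qed.

Lemma tameD F H : tame F -> tame H -> tame (fun a k => F a k + H a k).
Proof.
move=> [C HC] [D HD]; exists (C + D) => a ra.
have [rF bF] := HC a ra; have [rH bH] := HD a ra; split; first exact: rapidD.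
by rewrite sumsD// mulrDl; apply: le_trans (ler_normD _ _) _; exact: lerD.
Qed.

Lemma tameZ (x : R) F : tame F -> tame (fun a k => x * F a k).
Proof.
move=> [C HC]; exists (`|x| * C) => a ra; have [rF bF] := HC a ra.
split; first exact: rapidZ.
by rewrite sumsZ// normrM -mulrA ler_wpM2l.
Qed.

(** By |xy| <= x^2 + y^2 and the comparability of w at neighbouring indices. *)
Lemma tame_band c m n : (exists C : R, forall k, `|c k| <= C * w k) ->
  tame (fun a k => c k * a (k + m)%N * a (k + n)%N).
Proof.
move=> [C HC].
have w0 := weight_gt0 w_symbol.
have C0 : 0 <= C by rewrite -(pmulr_lge0 _ (w0 0%N)); apply: le_trans (HC 0%N).
have tc : tempered c.
  have [D [N [D0 HD]]] := tempered_const (weight_tempered w_symbol).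
  exists (C * D), N => k; apply: le_trans (HC k) _.
  by rewrite -mulrA ler_wpM2l// (le_trans (ler_norm _)).
have [K HK] := weight_le_addn w_symbol m.
have [L HL] := weight_le_addn w_symbol n.
have K0 : 0 <= K.
  by rewrite -(pmulr_lge0 _ (w0 m)); apply: le_trans (HK 0%N); exact: ltW.
have L0 : 0 <= L.
  by rewrite -(pmulr_lge0 _ (w0 n)); apply: le_trans (HL 0%N); exact: ltW.
exists (C * (K + L)) => a ra.
have ram := rapid_addn m ra; have ran := rapid_addn n ra.
have rF : rapid (fun k => c k * a (k + m)%N * a (k + n)%N).
  by apply: rapidM => //; exact: rapidM_tempered.
split=> //; apply: le_trans (ler_norm_sums rF) _.
have rwm := rapid_addn m (rapid_wnorm2 ra).
have rwn := rapid_addn n (rapid_wnorm2 ra).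
apply: (@le_trans _ _ (sums (fun k => C * K * (w (k + m)%N * a (k + m)%N ^+ 2)
    + C * L * (w (k + n)%N * a (k + n)%N ^+ 2)))).
  apply: ler_sums; [exact: rapid_norm|by apply: rapidD; exact: rapidZ|move=> k].
  rewrite -mulrA normrM.
  apply: le_trans (ler_wpM2r (normr_ge0 _) (HC k)) _.
  set x := a (k + m)%N; set y := a (k + n)%N.
  have xy : `|x * y| <= x ^+ 2 + y ^+ 2.
    by rewrite ler_norml; apply/andP; split; nra.
  have Kk := ler_wpM2r (sqr_ge0 x) (HK k).
  have Lk := ler_wpM2r (sqr_ge0 y) (HL k).
  have := ler_wpM2l C0 (ler_wpM2l (ltW (w0 k)) xy).
  by have := ler_wpM2l C0 (lerD Kk Lk); lra.
rewrite sumsD ?sumsZ//; do ?exact: rapidZ.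
rewrite mulrDr mulrDl lerD// ler_wpM2l ?mulr_ge0//.
  exact: wnorm2_tail.
exact: wnorm2_tail.
Qed.

(** Only the first i terms of V survive in the sum. *)
Lemma tame_telescope V i : (forall a, rapid a -> rapid (V a)) ->
  (forall k, exists C : R, forall a, rapid a -> `|V a k| <= C * wnorm2 a) ->
  tame (fun a k => V a k - V a (k + i)%N).
Proof.
move=> rV /choice[C HC]; exists (\sum_(k < i) C k) => a ra.
have raV := rV a ra; have rVi := rapid_addn i raV.
split; first exact: rapidB.
rewrite sumsB// (sums_shift i raV) addrK mulr_suml.
by apply: le_trans (ler_norm_sum _ _ _) _; apply: ler_sum => k _; exact: HC.
Qed.

Lemma entry_prod_le m n : exists C : R, forall a, rapid a ->
  `|a m * a n| <= C * wnorm2 a.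
Proof.
have w0 := weight_gt0 w_symbol.
exists ((w m)^-1 + (w n)^-1) => a ra.
have am : a m ^+ 2 <= (w m)^-1 * wnorm2 a.
  by rewrite ler_pdivlMl//; exact: wnorm2_entry.
have an : a n ^+ 2 <= (w n)^-1 * wnorm2 a.
  by rewrite ler_pdivlMl//; exact: wnorm2_entry.
rewrite mulrDl; apply: (le_trans _ (lerD am an)).
by rewrite ler_norml; apply/andP; split; nra.
Qed.

Lemma tame_telescope_prod c (m n : nat -> nat) i : tempered c ->
  (forall a, rapid a -> rapid (fun k => a (m k))) ->
  (forall a, rapid a -> rapid (fun k => a (n k))) ->
  tame (fun a k => c k * a (m k) * a (n k) -
                   c (k + i)%N * a (m (k + i)%N) * a (n (k + i)%N)).
Proof.
move=> tc rm rn.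
apply: (@tame_telescope (fun a k => c k * a (m k) * a (n k))).
  move=> a ra; apply: rapidM; last exact: rn.
  by apply: rapidM_tempered => //; exact: rm.
move=> k; have [C HC] := entry_prod_le (m k) (n k).
exists (`|c k| * C) => a ra.
by rewrite -mulrA normrM -mulrA ler_wpM2l// HC.
Qed.

(** In the Hermite basis, - d/dx is such an operator with j = 1, and phi |-> -(x phi)'
is one with j = 2 up to a scalar.  It is used with u k = 0 for k < j, so that
the truncation of k - j at 0 does no harm, and is then antisymmetric for the
unweighted scalar product. *)
Definition ladder (j : nat) u a (k : nat) : R :=
  u k * a (k - j)%N - u (k + j)%N * a (k + j)%N.

Lemma rapid_ladder j u a : tempered u -> rapid a -> rapid (ladder j u a).
Proof.
move=> tu ra; apply: rapidB; first by apply: rapidM_tempered => //; exact: rapid_subn.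
by apply: (rapid_addn j (a := fun k => u k * a k)); exact: rapidM_tempered.
Qed.

(** The decisive cancellation.  Expanding the ladder operator gives four products
of entries of a, with coefficients of size w k * k.  Shifting two of them by i
pairs all four; what remains in each pair is a difference of products t * u,
which by the Leibniz rule is of size w k. *)
Lemma tame_cross t u i j : symbol0 w t -> symbol1 u ->
  tame (fun a k => t k * (a k * ladder i u a (k + j)%N +
                          a (k + j)%N * ladder i u a k)).
Proof.
move=> tS uS.
have tt := symbol0_tempered w_symbol tS; have tu := symbol1_tempered uS.
pose P a k := t k * u (k + j)%N * a k * a (k + j - i)%N.
pose Z a k := t k * u k * a (k + j)%N * a (k - i)%N.
have [[Ct HCt] Hdt] := tS; have [Dt HDt] := Hdt i.
have Ct0 : 0 <= Ct.
  rewrite -(pmulr_lge0 _ (weight_gt0 w_symbol 0%N)).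
  by apply: le_trans (HCt 0%N).
(* A discrete Leibniz expansion whose terms are both O(w). *)
have bound v x y (c := fun k => (t (k + i)%N - t k) * v k + t k * (x k - y k)) :
    (exists C : R, forall k, `|v k| <= C * k.+1%:R) ->
    (exists C : R, forall k, `|x k - y k| <= C) ->
    exists C : R, forall k, `|c k| <= C * w k.
  move=> [A HA] [B HB].
  have A0 : 0 <= A by have := le_trans (normr_ge0 _) (HA 0%N); rewrite mulr1.
  exists (Dt * A + Ct * B) => k; rewrite /c.
  apply: le_trans (ler_normD _ _) _; rewrite [leRHS]mulrDl; apply: lerD.
    rewrite normrM.
    apply: (le_trans (ler_wpM2l (normr_ge0 _) (HA k))).
    by have := ler_wpM2l A0 (HDt k); lra.
  rewrite normrM; apply: le_trans (ler_pM _ _ (HCt k) (HB k)) _ => //.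
  by rewrite mulrAC.
apply: (@eq_tame _ (fun a k => (P a k - P a (k + i)%N) + (Z a k - Z a (k + i)%N)
   + ((t (k + i)%N - t k) * u (k + i + j)%N +
      t k * (u (k + i + j)%N - u (k + i)%N)) * a (k + i)%N * a (k + j)%N
   + ((t (k + i)%N - t k) * u (k + i)%N +
      t k * (u (k + i)%N - u (k + i + j)%N)) * a (k + 0)%N * a (k + (i + j))%N)).
  move=> a k; rewrite /P /Z /ladder addn0 addnK (addnAC k i j) addnK !addnA.
  rewrite (addnAC k i j).
  by ring.
apply: tameD; last first.
  apply: tame_band; apply: bound; first exact: (symbol1_addn i uS).1.
  have [B HB] := (symbol1_addn i uS).2 j; exists B => k; rewrite distrC.
  by rewrite addnAC; exact: HB.
apply: tameD; last first.
  apply: tame_band; apply: bound.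
    by have [[A HA] _] := symbol1_addn (i + j) uS; exists A => k; rewrite -addnA.
  have [B HB] := (symbol1_addn i uS).2 j; exists B => k.
  by rewrite addnAC; exact: HB.
apply: tameD.
  apply: (tame_telescope_prod (c := fun k => t k * u (k + j)%N) (m := id)
    (n := fun k => (k + j - i)%N)) => //.
  - by apply: temperedM => //; exact: tempered_shift.
  - by move=> a ra; apply: (rapid_addn j (rapid_subn i ra)).
apply: (tame_telescope_prod (c := fun k => t k * u k) (m := addn^~ j)
    (n := fun k => (k - i)%N)) => //.
- exact: temperedM.
- by move=> a ra; exact: rapid_addn.
- by move=> a ra; exact: rapid_subn.
Qed.

(** The ladder operator is antisymmetric for constant weights, so re-indexing by j
leaves only the differences w (k + j) - w k. *)
Lemma tame_skew j u (B : (nat -> R) -> nat -> R) : tempered u ->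
  (forall k, (k < j)%N -> u k = 0) ->
  (forall a, rapid a -> rapid (B a)) ->
  tame (fun a k => (w (k + j)%N - w k) * u (k + j)%N *
                   (a k * B a (k + j)%N + a (k + j)%N * B a k)) ->
  tame (fun a k => w k * (a k * ladder j u (B a) k + ladder j u a k * B a k)).
Proof.
move=> tu u0 rB tB; have tw := weight_tempered w_symbol.
pose V a k := w k * u k * (a k * B a (k - j)%N + a (k - j)%N * B a k).
(* V k vanishes for k < j, since u does. *)
have telV : tame (fun a k => V a k - V a (k + j)%N).
  exists 0 => a ra.
  have rVa : rapid (V a).
    have rBa := rB a ra.
    apply: rapidM_tempered; first exact: temperedM.
    by apply: rapidD; apply: rapidM => //; exact: rapid_subn.
  have rVj := rapid_addn j rVa.
  split; first exact: rapidB.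
  rewrite sumsB// (sums_shift j rVa) addrK mul0r big1 ?normr0// => k _.
  by rewrite /V u0 ?ltn_ord// mulr0 mul0r.
apply: eq_tame (tameD telV tB) => a k.
by rewrite /V /ladder addnK; ring.
Qed.

End TameFunctionals.

(** * Power weights *)

Section PowerWeights.
Context {R : realType}.

Lemma MVT_nonneg (f df : R -> R) (x y : R) :
  (forall z : R, 0 <= z -> is_derive z 1 f (df z)) -> 0 <= x -> x <= y ->
  exists2 z : R, x <= z <= y & f y - f x = df z * (y - x).
Proof.
move=> fdf x0 xy.
have [z zxy fz] : exists2 z, z \in `[x, y]%R & f y - f x = df z * (y - x).
  apply: MVT_segment => // [z|].
    by rewrite in_itv/= => /andP[xz _]; apply: fdf; lra.
  apply: derivable_within_continuous => z; rewrite in_itv/= => /andP[xz _].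
  have z0 : 0 <= z by lra.
  by have := fdf z z0.
by exists z => //; move: zxy; rewrite in_itv.
Qed.

Let pw (q x : R) : R := (2 * x + 1) `^ q.

Lemma is_derive_pw (q z : R) : 0 <= z -> is_derive z 1 (pw q) (2 * q * pw (q - 1) z).
Proof.
move=> z0; have z1 : 0 < 2 * z + 1 by lra.
have dl : is_derive z 1 (fun x : R => 2 * x + 1) 2.
  rewrite (_ : (fun x : R => _) = (2 \*: (id : R -> R)) + cst 1)//.
  by apply: is_derive_eq; rewrite addr0 -[LHS]/(2 * 1) mulr1.
have := is_derive1_comp (f := fun y : R => y `^ q) (g := fun x : R => 2 * x + 1)
  (is_derive1_powR q z1) dl.
by move=> h; apply: is_derive_eq h _; rewrite /pw; ring.
Qed.

(** Passing to the absolute value of the exponent treats r >= 0 and r < 0 at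
once. *)
Lemma powR_le_norm (r t M : R) : 1 <= t -> t <= M -> t `^ r <= M `^ `|r|.
Proof.
move=> t1 tM; apply: (@le_trans _ _ (t `^ `|r|)).
  by rewrite ler_powR// ler_norm.
by rewrite ge0_ler_powR// nnegrE; lra.
Qed.

Lemma pw_ratio (r : R) (j : nat) (k x : R) : 0 <= k -> k <= x <= k + j%:R ->
  pw r x <= (2 * j%:R + 1) `^ `|r| * pw r k /\
  pw r k <= (2 * j%:R + 1) `^ `|r| * pw r x.
Proof.
move=> k0 /andP[kx xk]; have j0 : 0 <= j%:R :> R by exact: ler0n.
have a0 : 0 < 2 * k + 1 by lra.
have b0 : 0 < 2 * x + 1 by lra.
pose t := (2 * x + 1) / (2 * k + 1).
have t1 : 1 <= t by rewrite ler_pdivlMr// mul1r; lra.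
have tM : t <= 2 * j%:R + 1.
  by rewrite ler_pdivrMr//; nra.
have xt : 2 * x + 1 = t * (2 * k + 1) by rewrite /t divfK// gt_eqF.
have pxt : pw r x = t `^ r * pw r k.
  by rewrite /pw xt powRM// ltW//; lra.
split; first by rewrite pxt ler_wpM2r ?powR_ge0//; exact: powR_le_norm.
have pkt : pw r k = t `^ (- r) * pw r x.
  rewrite pxt mulrA -powRD ?addNr ?powRr0 ?mul1r//.
  by apply/implyP => _; rewrite gt_eqF//; lra.
by rewrite pkt ler_wpM2r ?powR_ge0// -[`|r|]normrN; exact: powR_le_norm.
Qed.

(** The n-th derivative of (2x+1)^q is a multiple of (2x+1)^(q-n), and near k this
is smaller than (2k+1)^q by a factor k^n. *)
Lemma pw_decay (q : R) (n j : nat) : exists2 K : R, 0 <= K & forall k x : R,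
  0 <= k -> k <= x <= k + j%:R -> pw (q - n%:R) x * (k + 1) ^+ n <= K * pw q k.
Proof.
exists ((2 * j%:R + 1) `^ `|q - n%:R|) => [|k x k0 kx]; first exact: powR_ge0.
have [H _] := pw_ratio (q - n%:R) k0 kx.
have kn0 : 0 <= (k + 1) ^+ n by rewrite exprn_ge0//; lra.
apply: le_trans (ler_wpM2r kn0 H) _; rewrite -mulrA ler_wpM2l ?powR_ge0//.
have k1 : 0 < 2 * k + 1 by lra.
have -> : pw q k = pw (q - n%:R) k * (2 * k + 1) ^+ n.
  rewrite /pw -powR_mulrn ?ltW// -powRD ?subrK//.
  by apply/implyP => _; rewrite gt_eqF.
by rewrite ler_wpM2l ?powR_ge0// lerXn2r ?nnegrE//; lra.
Qed.

(** First differences are controlled by one use of the mean value theorem and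
second differences by two. *)
Lemma symbol_weight_pow (q : R) :
  symbol_weight (fun k : nat => (2 * k + 1)%:R `^ q).
Proof.
have wE : (fun k : nat => (2 * k + 1)%:R `^ q) = (fun k : nat => pw q k%:R).
  by apply/funext => k; rewrite /pw natrD natrM.
rewrite wE; have k0 k : 0 <= k%:R :> R by exact: ler0n.
have pwge0 r x : 0 <= pw r x by exact: powR_ge0.
split.
- by move=> k; rewrite powR_gt0//; have := k0 k; lra.
- have [N qN] : exists N : nat, q <= N%:R.
    by exists (Num.truncn `|q|).+1; rewrite (le_trans (ler_norm q))// ltW// truncnS_gt.
  exists (2 ^+ N), N => k; rewrite ger0_norm//.
  apply: (@le_trans _ _ ((2 * k%:R + 1) `^ N%:R)).
    by apply: ler_powR => //; have := k0 k; lra.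
  rewrite powR_mulrn; last by have := k0 k; lra.
  rewrite -exprMn lerXn2r ?nnegrE//.
  by rewrite -(nat1r k); lra.
- move=> j; exists ((2 * j%:R + 1) `^ `|q|) => k.
  have kj : (k%:R <= (k + j)%:R :> R) && ((k + j)%:R <= k%:R + j%:R :> R).
    by rewrite natrD lexx andbT lerDl.
  by have [_ ->] := pw_ratio q (k0 k) kj.
- move=> j; have [K K0 HK] := pw_decay q 1 j; exists (2 * j%:R * `|q| * K) => k.
  have kj : k%:R <= (k + j)%:R :> R by rewrite ler_nat leq_addr.
  have [z zk ->] := MVT_nonneg (is_derive_pw q) (k0 k) kj.
  rewrite natrD addrAC subrr add0r; rewrite natrD in zk.
  have := HK _ _ (k0 k) zk; rewrite expr1 natr1.
  have C0 : 0 <= 2 * j%:R * `|q| by rewrite !mulr_ge0.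
  move=> /(ler_wpM2l C0).
  rewrite !normrM (ger0_norm (pwge0 _ _)) (ger0_norm (k0 j)) (ger0_norm (k0 2%N)).
  by lra.
(* The second difference of w is the i-step difference of its j-step
   difference D. *)
- move=> i j; have [K K0 HK] := pw_decay q 2 (i + j).
  exists (4 * i%:R * j%:R * `|q| * `|q - 1| * K) => k.
  pose D x := pw q (x + j%:R) - pw q x.
  have dD (z : R) : 0 <= z ->
      is_derive z 1 D (2 * q * (pw (q - 1) (z + j%:R) - pw (q - 1) z)).
    move=> z0; have zj : 0 <= z + j%:R by rewrite addr_ge0.
    have dsh : is_derive z 1 (fun x : R => x + j%:R) 1.
      rewrite (_ : (fun x : R => _) = (id : R -> R) + cst j%:R)//.
      by apply: is_derive_eq; rewrite addr0.
    have h1 := is_derive1_comp (f := pw q) (g := fun x : R => x + j%:R)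
      (is_derive_pw q zj) dsh.
    by apply: is_derive_eq (is_deriveB h1 (is_derive_pw q z0)) _; ring.
  have ki : k%:R <= (k + i)%:R :> R by rewrite ler_nat leq_addr.
  have [z /andP[kz zi]] := MVT_nonneg dD (k0 k) ki.
  rewrite {1 2}/D -!natrD => ->.
  have z0 : 0 <= z by apply: le_trans kz.
  have zj : z <= z + j%:R by rewrite lerDl.
  have [y /andP[zy yj] ->] := MVT_nonneg (is_derive_pw (q - 1)) z0 zj.
  have kij : (k%:R <= y) && (y <= k%:R + (i + j)%:R).
    by rewrite natrD; rewrite natrD in zi; apply/andP; split; lra.
  have := HK _ _ (k0 k) kij; rewrite natr1.
  have -> : q - 1 - 1 = q - 2%:R by lra.
  have C0 : 0 <= 4 * i%:R * j%:R * `|q| * `|q - 1| by rewrite !mulr_ge0.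
  move=> /(ler_wpM2l C0).
  have -> : z + j%:R - z = j%:R by ring.
  have -> : (k + i)%:R - k%:R = i%:R :> R by rewrite natrD; ring.
  rewrite !normrM (ger0_norm (pwge0 _ _)) !(ger0_norm (k0 _)).
  by lra.
Qed.

End PowerWeights.

(** * The quadratic form on coefficient sequences *)

Section SequenceInequality.
Context {R : realType}.
Implicit Types (a w : nat -> R).

(** The number <x h_(k-1), h_k>, which is also <h_k', h_(k-1)>. *)
Definition lower (k : nat) : R := Num.sqrt (k%:R / 2).

(** Half of sqrt (k (k-1)). *)
Definition lower2 (k : nat) : R := lower k * lower k.-1.

Lemma lower_ge0 k : 0 <= lower k. Proof. exact: sqrtr_ge0. Qed.

Lemma sqr_lower k : lower k ^+ 2 = k%:R / 2.
Proof. by rewrite sqr_sqrtr// divr_ge0// ler0n. Qed.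

Lemma lower0 : lower 0 = 0.
Proof. by rewrite /lower mul0r sqrtr0. Qed.

Lemma lower_le k l : (k <= l)%N -> lower k <= lower l.
Proof. by move=> kl; rewrite ler_wsqrtr// ler_wpM2r ?invr_ge0// ler_nat. Qed.

Lemma symbol1_lower : symbol1 lower.
Proof.
split.
  exists 1 => k; rewrite ger0_norm ?lower_ge0// mul1r.
  have := sqr_lower k; have := lower_ge0 k; rewrite -(nat1r k).
  have : 0 <= k%:R :> R by exact: ler0n.
  by move: (lower k) (k%:R : R) => x y; nra.
move=> i; exists (lower i) => k.
have h1 : lower k <= lower (k + i) by rewrite lower_le// leq_addr.
rewrite ger0_norm ?subr_ge0//.
have := sqr_lower k; have := sqr_lower i; have := sqr_lower (k + i).
rewrite natrD; have := lower_ge0 k; have := lower_ge0 i.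
move: h1 (lower_ge0 (k + i)) => + +.
move: (lower k) (lower i) (lower (k + i)) (k%:R : R) (i%:R : R) => x y z p q.
move=> xz z0 y0 x0 zz yy xx; rewrite lerBlDl leNgt; apply/negP => h.
have : (x + y) * (x + y) < z * z by apply: ltr_pM; lra.
have := mulr_ge0 x0 y0.
by nra.
Qed.

Lemma lower2_bounds k : k%:R - 1 <= 2 * lower2 k <= k%:R.
Proof.
case: k => [|k]; first by rewrite /lower2 lower0 mul0r mulr0; apply/andP; split; lra.
have := sqr_lower k; have := sqr_lower k.+1; rewrite /lower2/= -(nat1r k).
have := lower_ge0 k; have := lower_le (leqnSn k).
move: (lower k) (lower k.+1) (k%:R : R) => x y n xy x0 yy xx.
by apply/andP; split; nra.
Qed.

Lemma symbol1_lower2 : symbol1 lower2.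
Proof.
have l0 k : 0 <= lower2 k by rewrite mulr_ge0 ?lower_ge0.
split.
  exists 1 => k; rewrite ger0_norm// mul1r.
  have /andP[_ h] := lower2_bounds k; have := l0 k; rewrite -(nat1r k).
  have : 0 <= k%:R :> R by exact: ler0n.
  by lra.
move=> i; exists (i%:R + 1) => k.
have /andP[h1 h2] := lower2_bounds k; have /andP[] := lower2_bounds (k + i).
have : 0 <= i%:R :> R by exact: ler0n.
by rewrite natrD => h3 h4 h5; rewrite ler_norml; apply/andP; split; lra.
Qed.

Lemma lower2_eq0 k : (k < 2)%N -> lower2 k = 0.
Proof. by case: k => [|[|]]// _; rewrite /lower2 lower0 ?mul0r ?mulr0. Qed.

(** [adj_coef x y] is the matrix of phi |-> -(sigma phi)' in the Hermite basis for
sigma(t) = x t + y, and [adj_skew x y] its antisymmetric part. *)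
Definition adj_skew (x y : R) a (k : nat) : R :=
  ladder 2 (fun k => x * lower2 k) a k + ladder 1 (fun k => y * lower k) a k.

Definition adj_coef (x y : R) a (k : nat) : R :=
  adj_skew x y a k - x / 2 * a k.

Lemma rapid_adj_skew x y a : rapid a -> rapid (adj_skew x y a).
Proof.
move=> ra; apply: rapidD; apply: rapid_ladder => //.
  exact/symbol1_tempered/symbol1Z/symbol1_lower2.
exact/symbol1_tempered/symbol1Z/symbol1_lower.
Qed.

Section Weighted.
Variable w : nat -> R.
Hypothesis w_symbol : symbol_weight w.

Lemma tame_adj_skew_gen x y (B : (nat -> R) -> nat -> R) :
  (forall a, rapid a -> rapid (B a)) ->
  (forall j u, symbol1 u -> tame w (fun a k => (w (k + j)%N - w k) * u (k + j)%N *
                   (a k * B a (k + j)%N + a (k + j)%N * B a k))) ->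
  tame w (fun a k => w k * (a k * adj_skew x y (B a) k + adj_skew x y a k * B a k)).
Proof.
move=> rB tB.
have s2 := symbol1Z x symbol1_lower2; have s1 := symbol1Z y symbol1_lower.
have v2 k : (k < 2)%N -> x * lower2 k = 0 by move=> /lower2_eq0 ->; rewrite mulr0.
have v1 k : (k < 1)%N -> y * lower k = 0.
  by rewrite ltnS leqn0 => /eqP ->; rewrite lower0 mulr0.
apply: eq_tame (tameD (tame_skew w_symbol (symbol1_tempered s2) v2 rB (tB _ _ s2))
  (tame_skew w_symbol (symbol1_tempered s1) v1 rB (tB _ _ s1))) => a k.
by rewrite /adj_skew; ring.
Qed.

Lemma tame_adj_skew x y : tame w (fun a k => w k * (a k * adj_skew x y a k)).
Proof.
have h : tame w (fun a k => w k * (a k * adj_skew x y a k + adj_skew x y a k * a k)).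
  apply: tame_adj_skew_gen => // j u su.
  have [bt _] := symbol0_diff j w_symbol (symbol1_addn j su).
  apply: eq_tame (tameZ 2 (tame_band w_symbol 0 j bt)) => a k.
  by rewrite addn0; ring.
by apply: eq_tame (tameZ 2^-1 h) => a k; field.
Qed.

(** This is where the two second-order terms of the inequality compensate: each is
of size k^2 alone, but together they are the skew form of [tame_skew] with
[adj_skew x y] applied on one side, a sum of the forms of [tame_cross]. *)
Lemma tame_adj_skew2 x y : tame w (fun a k =>
  w k * (a k * adj_skew x y (adj_skew x y a) k + adj_skew x y a k ^+ 2)).
Proof.
apply: (@tame_adj_skew_gen x y (adj_skew x y)) => [a|j u su].
  exact: rapid_adj_skew.
have st := symbol0_diff j w_symbol (symbol1_addn j su).
apply: eq_tame (tameD
  (tame_cross w_symbol 2 j st (symbol1Z x symbol1_lower2))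
  (tame_cross w_symbol 1 j st (symbol1Z y symbol1_lower))) => a k.
by rewrite /adj_skew; ring.
Qed.

(** Substituting A = G - x/2, the form splits into the second-order part, first-order
parts and a multiple of the weighted norm. *)
Lemma tame_adj_form x y x' y' : tame w (fun a k =>
  2 * (w k * a k * (2^-1 * adj_coef x y (adj_coef x y a) k
        - x / 2 * adj_coef x y a k + adj_coef x' y' a k))
  + w k * adj_coef x y a k ^+ 2).
Proof.
have tw : tame w (fun a k => w k * a (k + 0)%N * a (k + 0)%N).
  apply: tame_band => //; exists 1 => k.
  by rewrite mul1r ger0_norm// ltW// weight_gt0.
apply: eq_tame (tameD (tameD (tame_adj_skew2 x y) (tameZ (- (3 * x)) (tame_adj_skew x y)))
  (tameD (tameZ 2 (tame_adj_skew x' y')) (tameZ (x ^+ 2 - x') tw))) => a k.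
rewrite addn0 /adj_coef /adj_skew /ladder.
by field.
Qed.

End Weighted.
End SequenceInequality.

(** * Integrals over the line *)

Section LineIntegrals.
Context {R : realType}.
Notation mu := (@lebesgue_measure R).
Implicit Types (f g u : R -> R).

Lemma integrable_oneDsqrV :
  mu.-integrable [set: R] (EFin \o (fun x => (oneDsqr x)^-1)).
Proof.
have mo : measurable_fun [set: R] (fun x : R => (oneDsqr x)^-1).
  by apply: continuous_measurable_fun; exact: continuous_oneDsqrV.
apply/integrableP; split; first exact/measurable_EFinP.
apply/abse_integralP => //=; first exact/measurable_EFinP.
rewrite ge0_symfun_integralT//=.
- rewrite (_ : [set x | _] = `[0, +oo[%classic); last first.
    by apply/seteqP; split => x/=; rewrite in_itv/= andbT.
  by rewrite integral0y_oneDsqr -EFinM/= ltry.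
- exact: continuous_oneDsqrV.
- by move=> x; rewrite /oneDsqr /= sqrrN.
Qed.

Lemma integrable_decay f (M : R) : continuous f ->
  (forall x, `|f x| <= M * (oneDsqr x)^-1) ->
  mu.-integrable [set: R] (EFin \o f).
Proof.
move=> cf fM.
have ig : mu.-integrable [set: R] (EFin \o (fun x => M * (oneDsqr x)^-1)).
  exact: (integrableZl measurableT M integrable_oneDsqrV).
apply: le_integrable ig => //.
- by apply/measurable_EFinP; exact: continuous_measurable_fun.
- by move=> x _ /=; rewrite lee_fin (le_trans (fM x))// ler_norm.
Qed.

Lemma cvg_oneDsqrV_nat : (oneDsqr (n.+1%:R : R))^-1 @[n --> \oo] --> (0 : R).
Proof.
apply: (@squeeze_cvgr _ _ _ _ (cst 0) (@harmonic R)).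
- near=> n; rewrite /= invr_ge0 addr_ge0 ?sqr_ge0//=.
  rewrite /harmonic/= lef_pV2 ?posrE ?ltr0n//.
  have : 1 <= n.+1%:R :> R by rewrite ler1n.
  by rewrite /oneDsqr expr2; nra.
- exact: cvg_cst.
- exact: cvg_harmonic.
Unshelve. all: by end_near. Qed.

(** The fundamental theorem of calculus gives u n - u (-n) on the interval [-n, n];
the integrals converge to the integral over the line by domination, and the
boundary values tend to 0. *)
Lemma Rintegral_derive_eq0 u du (M : R) :
  (forall x : R, is_derive x 1 u (du x)) -> continuous du ->
  (forall x, `|du x| <= M * (oneDsqr x)^-1) ->
  (forall x, `|u x| <= M * (oneDsqr x)^-1) ->
  (\int[mu]_x du x)%R = 0.
Proof.
move=> udu cdu duM uM.
pose I (n : nat) : set R := `[- n.+1%:R, n.+1%:R]%classic.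
have cu : continuous u.
  move=> x; apply/differentiable_continuous/derivable1_diffP.
  by have := udu x.
have mdu : measurable_fun [set: R] du by exact: continuous_measurable_fun.
have FTC n : (\int[mu]_x ((EFin \o du) \_ (I n)) x = (u n.+1%:R - u (- n.+1%:R))%:E)%E.
  rewrite -integral_mkcond; apply: continuous_FTC2.
  - by rewrite gtrN// ltr0n.
  - exact: continuous_subspaceT.
  - split=> [x _||]; first by have := udu x.
      by apply: cvg_at_right_filter; exact: cu.
    by apply: cvg_at_left_filter; exact: cu.
  - by move=> x _; rewrite derive1E; have := udu x => h; rewrite derive_val.
have mres n : measurable_fun [set: R] ((EFin \o du) \_ (I n)).
  apply/(measurable_restrictT _ _).1; first exact: measurable_itv.
  by apply: measurable_funTS; exact/measurable_EFinP.
have mlim : measurable_fun [set: R] (EFin \o du) by exact/measurable_EFinP.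
have reslim : {ae mu, forall x, [set: R] x ->
    ((EFin \o du) \_ (I n)) x @[n --> \oo] --> (EFin \o du) x}.
  apply: aeW => x _; apply: cvg_near_cst.
  near=> n; rewrite patchE mem_set// /I /= in_itv/= -ler_norml.
  near: n; exists (Num.truncn `|x|) => // m /= xm.
  by rewrite ltW// (lt_le_trans (truncnS_gt _))// ler_nat ltnS.
have idom := integrableZl measurableT M integrable_oneDsqrV.
have resdom : {ae mu, forall x n, [set: R] x ->
    (`|((EFin \o du) \_ (I n)) x| <= M%:E * ((oneDsqr x)^-1)%R%:E)%E}.
  apply: aeW => x n _; rewrite patchE; case: ifPn => _ /=.
    by rewrite lee_fin.
  by rewrite normr0 lee_fin (le_trans (normr_ge0 _) (duM x)).
have [_ _ DCT] := @dominated_convergence _ _ _ mu _ measurableT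
  (fun n => (EFin \o du) \_ (I n)) _ _ mres mlim reslim idom resdom.
have lim0 : (\int[mu]_x ((EFin \o du) \_ (I n)) x @[n --> \oo] --> 0)%E.
  under eq_fun do rewrite FTC.
  apply: cvg_EFin; first by near=> n.
  have h : M * (oneDsqr (n.+1%:R : R))^-1 @[n --> \oo] --> (0 : R).
    by rewrite -[X in _ --> X](mulr0 M); apply: cvgMl_tmp; exact: cvg_oneDsqrV_nat.
  have up : u n.+1%:R @[n --> \oo] --> (0 : R).
    apply: norm_cvg0; apply: (@squeeze_cvgr _ _ _ _ (cst 0)
      (fun n : nat => M * (oneDsqr (n.+1%:R : R))^-1)) => //.
      by near=> n; rewrite /= normr_ge0/= uM.
    exact: cvg_cst.
  have um : u (- n.+1%:R) @[n --> \oo] --> (0 : R).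
    apply: norm_cvg0; apply: (@squeeze_cvgr _ _ _ _ (cst 0)
      (fun n : nat => M * (oneDsqr (n.+1%:R : R))^-1)) => //.
      near=> n; rewrite /= normr_ge0/=; apply: le_trans (uM _) _.
      by rewrite /oneDsqr sqrrN.
    exact: cvg_cst.
  by rewrite -[X in _ --> X](subr0 0); exact: cvgB.
rewrite /Rintegral (_ : (\int[mu]_x _)%E = 0%E)//.
apply: cvg_unique lim0; first exact: ereal_hausdorff.
exact: DCT.
Unshelve. all: by end_near. Qed.

End LineIntegrals.

(** * Schwartz functions *)

Section Schwartz.
Context {R : realType}.
Notation mu := (@lebesgue_measure R).
Implicit Types (f g h : R -> R).

Lemma schwartz_is_derive f (x : R) : schwartz f -> is_derive x 1 f (f^`()%classic x).
Proof. by move=> [sf _]; rewrite derive1E; apply/derivableP; exact: (sf 0%N). Qed.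

Lemma schwartz_derive f : schwartz f -> schwartz f^`()%classic.
Proof.
have E n : (f^`())^`(n)%classic = f^`(n.+1)%classic by rewrite /derive1n iterSr.
move=> [sf bf]; split=> [n x|m n]; first by rewrite E.
by rewrite E.
Qed.

Lemma schwartz_decay f m : schwartz f -> exists M : R, forall x, `|x ^+ m * f x| <= M.
Proof. by move=> [_ /(_ m 0%N)]. Qed.

Lemma schwartz_continuous f : schwartz f -> continuous f.
Proof.
move=> sf x; apply/differentiable_continuous/derivable1_diffP.
by have := schwartz_is_derive x sf.
Qed.

(** A coinduction principle: a class of functions stable under differentiation and
consisting of functions that decay faster than every power consists of
Schwartz functions.  It replaces the higher Leibniz formulas in the closure
properties below. *)
Lemma schwartz_coind (P : (R -> R) -> Prop) :
  (forall f, P f -> exists2 df, P df &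
     (forall x : R, is_derive x 1 f (df x)) /\
     forall m : nat, exists M : R, forall x, `|x ^+ m * f x| <= M) ->
  forall f, P f -> schwartz f.
Proof.
move=> coP f Pf.
have Pn n : P f^`(n)%classic.
  elim: n => [//|n /coP[df Pdf [fdf _]]].
  rewrite derive1nS (_ : _^`()%classic = df)//.
  by apply/funext => x; rewrite derive1E; have h := fdf x; rewrite derive_val.
split=> [n x|m n]; have [df _ [fdf bf]] := coP _ (Pn n); last exact: bf.
by have := fdf x.
Qed.

Lemma schwartz_lincomb (c d : R) f g : schwartz f -> schwartz g ->
  schwartz (fun x => c * f x + d * g x).
Proof.
move=> sf sg.
apply: (@schwartz_coind (fun h => exists f g, [/\ schwartz f, schwartz g &
   h = fun x => c * f x + d * g x])); last by exists f, g.
move=> _ {f g sf sg} [f [g [sf sg ->]]].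
exists (fun x => c * f^`()%classic x + d * g^`()%classic x).
  by exists f^`()%classic, g^`()%classic; split => //; exact: schwartz_derive.
split=> [x|m].
  have df := schwartz_is_derive x sf; have dg := schwartz_is_derive x sg.
  exact: (is_deriveD (is_deriveZ c df) (is_deriveZ d dg)).
have [M HM] := schwartz_decay m sf; have [N HN] := schwartz_decay m sg.
exists (`|c| * M + `|d| * N) => x.
rewrite mulrDr (mulrCA _ c) (mulrCA _ d).
apply: le_trans (ler_normD _ _) _; rewrite !(normrM c) !(normrM d).
by rewrite lerD// ler_wpM2l.
Qed.

Lemma is_derive_affineM (c d : R) f df (x : R) : is_derive x 1 f df ->
  is_derive x 1 (fun y => (c * y + d) * f y) (c * f x + (c * x + d) * df).
Proof.
move=> fdf.
have h : is_derive x 1 ((c \*: (id : R -> R)) + cst d) c.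
  by apply: is_derive_eq; rewrite addr0 -[LHS]/(c * 1) mulr1.
apply: is_derive_eq (is_deriveM h fdf) _.
by rewrite /GRing.scale/= -[X in X * df]/(c * x + d); ring.
Qed.

(** Functions x * f + g form the stable class, since
(x f + g)' = x f' + (f + g'). *)
Lemma schwartz_X f : schwartz f -> schwartz (fun x => x * f x).
Proof.
move=> sf.
apply: (@schwartz_coind (fun h => exists f g, [/\ schwartz f, schwartz g &
   h = fun x => x * f x + g x])); last first.
  exists f, (fun x => 0 * f x + 0 * f x); split => //; first exact: schwartz_lincomb.
  by apply/funext => x; ring.
move=> _ {f sf} [f [g [sf sg ->]]].
exists (fun x => x * f^`()%classic x + (1 * f x + 1 * g^`()%classic x)).
  exists f^`()%classic, (fun x => 1 * f x + 1 * g^`()%classic x); split => //.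
    exact: schwartz_derive.
  by apply: schwartz_lincomb => //; exact: schwartz_derive.
split=> [x|m].
  have df := schwartz_is_derive x sf; have dg := schwartz_is_derive x sg.
  have h := is_deriveD (is_derive_affineM 1 0 df) dg.
  rewrite (_ : (fun y => _) = (fun y => (1 * y + 0) * f y) + g); last first.
    by apply/funext => y; rewrite -[RHS]/((1 * y + 0) * f y + g y) mul1r addr0.
  by apply: is_derive_eq h _; ring.
have [M HM] := schwartz_decay m.+1 sf; have [N HN] := schwartz_decay m sg.
exists (M + N) => x; rewrite mulrDr mulrA -exprSr.
by apply: le_trans (ler_normD _ _) _; rewrite lerD.
Qed.

Lemma schwartz_affine (c d : R) f : schwartz f -> schwartz (fun x => (c * x + d) * f x).
Proof.
move=> sf; have := schwartz_lincomb c d (schwartz_X sf) sf.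
by congr schwartz; apply/funext => x; ring.
Qed.

Lemma derive_affineM (c d : R) f (x : R) : schwartz f ->
  (fun y => (c * y + d) * f y)^`()%classic x = c * f x + (c * x + d) * f^`()%classic x.
Proof.
move=> sf; have h := is_derive_affineM c d (schwartz_is_derive x sf).
by rewrite derive1E derive_val.
Qed.

Lemma derive_lincomb (c d : R) f g (x : R) : schwartz f -> schwartz g ->
  (fun y => c * f y + d * g y)^`()%classic x = c * f^`()%classic x + d * g^`()%classic x.
Proof.
move=> sf sg.
have df := schwartz_is_derive x sf; have dg := schwartz_is_derive x sg.
have h : is_derive x 1 (fun y => c * f y + d * g y) _ :=
  is_deriveD (is_deriveZ c df) (is_deriveZ d dg).
by rewrite derive1E derive_val.
Qed.

Lemma schwartz_prod_decay f g : schwartz f -> schwartz g ->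
  exists M : R, forall x, `|f x * g x| <= M * (oneDsqr x)^-1.
Proof.
move=> sf sg; have [M HM] := schwartz_decay 0 sf; have [N HN] := schwartz_decay 0 sg.
have [K HK] := schwartz_decay 2 sg; exists (M * (N + K)) => x.
have o0 : 0 < oneDsqr x by rewrite /oneDsqr ltr_pwDl// sqr_ge0.
rewrite ler_pdivlMr// normrM -mulrA ler_pM// ?mulr_ge0 ?(ltW o0)//.
  by have := HM x; rewrite expr0 mul1r.
rewrite /oneDsqr mulrDr mulr1 lerD//; first by have := HN x; rewrite expr0 mul1r.
by have := HK x; rewrite normrM ger0_norm ?sqr_ge0// mulrC.
Qed.

Lemma schwartz_integrable f g : schwartz f -> schwartz g ->
  mu.-integrable [set: R] (EFin \o (fun x => f x * g x)).
Proof.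
move=> sf sg; have [M HM] := schwartz_prod_decay sf sg.
apply: integrable_decay HM => x.
by apply: cvgM; exact: schwartz_continuous.
Qed.

Lemma L2_lincomb (c d : R) f g h : schwartz f -> schwartz g -> schwartz h ->
  L2_inner (fun x => c * f x + d * g x) h = c * L2_inner f h + d * L2_inner g h.
Proof.
move=> sf sg sh; have ifh := schwartz_integrable sf sh.
have igh := schwartz_integrable sg sh.
rewrite /L2_inner -!RintegralZl// -RintegralD//.
- by apply: eq_Rintegral => x _; ring.
- exact: (integrableZl measurableT c ifh).
- exact: (integrableZl measurableT d igh).
Qed.

Lemma L2C f g : L2_inner f g = L2_inner g f.
Proof. by apply: eq_Rintegral => x _; rewrite mulrC. Qed.

Lemma L2_X f g : L2_inner (fun x => x * f x) g = L2_inner f (fun x => x * g x).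
Proof. by apply: eq_Rintegral => x _; ring. Qed.

Lemma L2_derive f g : schwartz f -> schwartz g ->
  L2_inner f^`()%classic g = - L2_inner f g^`()%classic.
Proof.
move=> sf sg; have sdf := schwartz_derive sf; have sdg := schwartz_derive sg.
apply/eqP; rewrite -addr_eq0 /L2_inner -RintegralD//; last 2 first.
- exact: schwartz_integrable.
- exact: schwartz_integrable.
have [M HM] := schwartz_prod_decay sdf sg; have [N HN] := schwartz_prod_decay sf sdg.
have [K HK] := schwartz_prod_decay sf sg.
have o0 x : 0 <= (oneDsqr x)^-1 :> R by rewrite invr_ge0 addr_ge0// sqr_ge0.
apply/eqP; apply: (@Rintegral_derive_eq0 _ (fun x => f x * g x) _ (`|M| + `|N| + `|K|)).
- move=> x; have df := schwartz_is_derive x sf; have dg := schwartz_is_derive x sg.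
  apply: is_derive_eq (is_deriveM df dg) _.
  by rewrite -[_ *: (g^`() x)%classic]/(_ * _) -[_ *: (f^`() x)%classic]/(_ * _); ring.
- move=> x; apply: cvgD; apply: cvgM; exact: schwartz_continuous.
- move=> x; apply: le_trans (ler_normD _ _) _.
  apply: le_trans (lerD (HM x) (HN x)) _; rewrite -mulrDl ler_wpM2r//.
  by rewrite -[leLHS]addr0 lerD// lerD// ler_norm.
- move=> x; apply: le_trans (HK x) _; rewrite ler_wpM2r//.
  by apply: le_trans (ler_norm _) _; rewrite lerDr addr_ge0.
Qed.

End Schwartz.

(** * Hermite functions *)

Section HermiteFunctions.
Context {R : realType}.
Implicit Types (p : {poly R}) (f : R -> R).

Lemma is_derive_poly_gauss p (x : R) :
  is_derive x 1 (fun y => p.[y] * expR (- (y ^+ 2 / 2)))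
    ((p^`() - 'X * p).[x] * expR (- (x ^+ 2 / 2))).
Proof.
have dsq : is_derive x 1 (fun y : R => - (y ^+ 2 / 2)) (- x).
  have h : is_derive x 1 ((- 2^-1) \*: ((id : R -> R) ^+ 2)) (- x).
    by apply: is_derive_eq; rewrite /GRing.scale/= expr1; field.
  by move: h; congr is_derive; apply/funext => y; rewrite -[LHS]/(- 2^-1 * (y * y)) expr2; ring.
have dexp := is_derive1_comp (f := expR) (g := fun y : R => - (y ^+ 2 / 2))
  (is_derive_expR (- (x ^+ 2 / 2))) dsq.
apply: is_derive_eq (is_deriveM (is_derive_poly p x) dexp) _.
rewrite /GRing.scale/= hornerD hornerN hornerM hornerX.
set e := expR _; set u := p.[x]; set v := _.[x].
by rewrite -[LHS]/(u * (e * - x) + e * v); ring.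
Qed.

(** From 1 + y^(m+1) / (m+1)! <= exp y at y = x^2/2, together with
|x|^m <= 1 + |x|^(2m+2). *)
Lemma monomial_gauss_bounded m : exists M : R, forall x : R,
  `|x ^+ m * expR (- (x ^+ 2 / 2))| <= M.
Proof.
exists (2 ^+ m.+1 * (m.+1)`!%:R) => x.
rewrite expRN normrM normrV ?unitfE ?expR_eq0// (ger0_norm (expR_ge0 _)).
rewrite ler_pdivrMr ?expR_gt0//.
have y0 : 0 <= x ^+ 2 / 2 by rewrite divr_ge0// sqr_ge0.
apply: (@le_trans _ _ (2 ^+ m.+1 * (m.+1)`!%:R * (1 + (x ^+ 2 / 2) ^+ m.+1 / (m.+1)`!%:R))); last first.
  by rewrite ler_wpM2l ?mulr_ge0 ?exprn_ge0 ?ler0n// expR_ge1Dxn.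
have f0 : (m.+1)`!%:R != 0 :> R by rewrite pnatr_eq0 -lt0n fact_gt0.
rewrite mulrDr mulr1 expr_div_n.
rewrite (_ : _ * _ * (_ / _ / _) = `|x| ^+ (2 * m.+1)); last first.
  rewrite exprM real_normK ?num_real//; field.
  by rewrite f0 expf_neq0.
rewrite normrX; have [x1|x1] := leP `|x| 1.
  apply: (@le_trans _ _ 1); first by rewrite exprn_ile1.
  rewrite -[leLHS]addr0 lerD ?exprn_ge0//.
  by rewrite mulr_ege1 ?ler1n ?fact_gt0// exprn_ege1// ler1n.
apply: (@le_trans _ _ (`|x| ^+ (2 * m.+1))).
  by rewrite ler_weXn2l ?(ltW x1)//; lia.
by rewrite lerDr mulr_ge0 ?exprn_ge0.
Qed.

Lemma poly_gauss_bounded p m : exists M : R, forall x : R,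
  `|x ^+ m * (p.[x] * expR (- (x ^+ 2 / 2)))| <= M.
Proof.
elim/poly_ind: p m => [m|p c IH m].
  by exists 0 => x; rewrite horner0 mul0r mulr0 normr0.
have [M HM] := IH m.+1; have [N HN] := monomial_gauss_bounded m.
exists (M + `|c| * N) => x; rewrite hornerMXaddC.
rewrite [X in `|X|](_ : _ = x ^+ m.+1 * (p.[x] * expR (- (x ^+ 2 / 2)))
  + c * (x ^+ m * expR (- (x ^+ 2 / 2)))); last by rewrite (exprS x m); ring.
by apply: le_trans (ler_normD _ _) _; rewrite (normrM c) lerD// ler_wpM2l.
Qed.

Lemma schwartz_poly_gauss p : schwartz (fun x => p.[x] * expR (- (x ^+ 2 / 2))).
Proof.
apply: (@schwartz_coind _ (fun f => exists p, f = fun x => p.[x] * expR (- (x ^+ 2 / 2)))).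
  move=> _ [q ->]; exists (fun x => (q^`() - 'X * q).[x] * expR (- (x ^+ 2 / 2))).
    by exists (q^`() - 'X * q).
  by split=> [x|m]; [exact: is_derive_poly_gauss|exact: poly_gauss_bounded].
by exists p.
Qed.

Lemma schwartz_hermite k : schwartz (@hermite_fun R k).
Proof.
have := schwartz_poly_gauss ((Num.sqrt (2 ^+ k * k`!%:R * Num.sqrt pi))^-1%:P * hermite_poly R k).
by congr schwartz; apply/funext => x; rewrite /hermite_fun hornerM hornerC; ring.
Qed.

Lemma deriv_hermite_poly k :
  (hermite_poly R k.+1)^`() = (2 * k.+1%:R) *: hermite_poly R k.
Proof.
elim: k => [|k IH].
  by rewrite /= -polyC1 derivC subr0 polyC1 mulr1 derivMn derivX mulr1 scaler_nat.
rewrite [hermite_poly R k.+2]/= -/(hermite_poly R k.+1).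
rewrite derivB derivM derivMn derivX IH derivZ.
have -> : (hermite_poly R k)^`() = 'X *+ 2 * hermite_poly R k - hermite_poly R k.+1.
  by rewrite /= opprB addrCA subrr addr0.
rewrite -!natrM !scaler_nat (_ : (2 * k.+2 = 2 * k.+1 + 2)%N); last by lia.
by rewrite mulrnDr mulrnBl mulrnAr; ring.
Qed.

Lemma hermite_poly_rec k (x : R) :
  (hermite_poly R k.+1).[x] = 2 * x * (hermite_poly R k).[x] - (hermite_poly R k)^`().[x].
Proof. by rewrite /= !hornerE; ring. Qed.

Local Notation nrm k := ((Num.sqrt (2 ^+ k * k`!%:R * Num.sqrt (pi : R)))^-1).

(** The square root that normalises h_k grows by a factor
sqrt (2k+2) = 2 sqrt ((k+1)/2). *)
Lemma hermite_norm_rec k : nrm k = 2 * lower k.+1 * nrm k.+1.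
Proof.
have s0 : 0 <= Num.sqrt (pi : R) by exact: sqrtr_ge0.
have sp : 0 < Num.sqrt (pi : R) by rewrite sqrtr_gt0 pi_gt0.
have k0 : 0 < 2 ^+ k * k`!%:R * Num.sqrt (pi : R).
  by rewrite !mulr_gt0 ?exprn_gt0 ?ltr0n ?fact_gt0.
have -> : Num.sqrt (2 ^+ k.+1 * (k.+1)`!%:R * Num.sqrt (pi : R))
    = 2 * lower k.+1 * Num.sqrt (2 ^+ k * k`!%:R * Num.sqrt (pi : R)).
  have -> : 2 * lower k.+1 = Num.sqrt (2 * k.+1%:R) :> R.
    rewrite -[2 in LHS]ger0_norm// -sqrtr_sqr -sqrtrM ?sqr_ge0//.
    by congr Num.sqrt; field.
  rewrite -sqrtrM ?mulr_ge0 ?ler0n//; congr Num.sqrt.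
  by rewrite factS natrM exprS; ring.
have l0 : lower k.+1 != 0 :> R.
  by rewrite gt_eqF// sqrtr_gt0 divr_gt0// ltr0n.
have n0 : Num.sqrt (2 ^+ k * k`!%:R * Num.sqrt (pi : R)) != 0.
  by rewrite gt_eqF// sqrtr_gt0.
by field; apply/andP.
Qed.

Lemma hermite_X k (x : R) : x * hermite_fun k x =
  lower k * hermite_fun k.-1 x + lower k.+1 * hermite_fun k.+1 x.
Proof.
rewrite /hermite_fun; set e := expR _.
have nk := hermite_norm_rec k.
have E : lower k.+1 * (nrm k.+1 * e * (hermite_poly R k.+1).[x]) =
   nrm k * e / 2 * (hermite_poly R k.+1).[x].
  by move: nk; move: (nrm k) (nrm k.+1) => n0 n1 ->; field.
rewrite E hermite_poly_rec; case: k {E nk} => [|k].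
  rewrite lower0 mul0r add0r -[hermite_poly R 0]/(1%:P) derivC hornerC horner0.
  by move: (nrm 0) => n; field.
rewrite deriv_hermite_poly hornerZ [k.+1.-1]/=.
have := sqr_lower (R := R) k.+1; rewrite (hermite_norm_rec k).
move: (lower k.+1 : R) (nrm k.+1) => l n ll.
have -> : k.+1%:R = 2 * l ^+ 2 by rewrite ll; field.
by field.
Qed.

Lemma derive_hermite k (x : R) : (@hermite_fun R k)^`()%classic x =
  lower k * hermite_fun k.-1 x - lower k.+1 * hermite_fun k.+1 x.
Proof.
have E : lower k.+1 * hermite_fun k.+1 x =
   nrm k * expR (- (x ^+ 2 / 2)) / 2 * (hermite_poly R k.+1).[x].
  rewrite /hermite_fun; move: (hermite_norm_rec k).
  by move: (nrm k) (nrm k.+1) => n0 n1 ->; field.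
have -> : lower k * hermite_fun k.-1 x = x * hermite_fun k x - lower k.+1 * hermite_fun k.+1 x.
  by rewrite hermite_X addrK.
rewrite E.
have h := is_derive_poly_gauss ((nrm k)%:P * hermite_poly R k) x.
have -> : @hermite_fun R k = fun x => ((nrm k)%:P * hermite_poly R k).[x] * expR (- (x ^+ 2 / 2)).
  by apply/funext => y; rewrite /hermite_fun hornerM hornerC; ring.
rewrite derive1E derive_val hermite_poly_rec derivM derivC mul0r add0r.
rewrite hornerD hornerN !hornerM !hornerC hornerX /hermite_fun.
by move: (nrm k) => n; field.
Qed.

End HermiteFunctions.

(** * Hermite coefficients *)

Section HermiteCoefficients.
Context {R : realType}.
Implicit Types (f g : R -> R).

Definition hcoef f (k : nat) : R := L2_inner f (hermite_fun k).

Lemma hcoef_lincomb (c d : R) f g k : schwartz f -> schwartz g ->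
  hcoef (fun x => c * f x + d * g x) k = c * hcoef f k + d * hcoef g k.
Proof. by move=> sf sg; exact/L2_lincomb/schwartz_hermite. Qed.

Lemma hcoef_X f k : schwartz f -> hcoef (fun x => x * f x) k =
  lower k * hcoef f k.-1 + lower k.+1 * hcoef f k.+1.
Proof.
move=> sf; rewrite /hcoef L2_X.
under [X in L2_inner f X]eq_fun do rewrite hermite_X.
by rewrite L2C L2_lincomb ?(L2C f)//; exact: schwartz_hermite.
Qed.

Lemma hcoef_derive f k : schwartz f -> hcoef f^`()%classic k =
  - lower k * hcoef f k.-1 + lower k.+1 * hcoef f k.+1.
Proof.
move=> sf; have sh j := @schwartz_hermite R j.
rewrite /hcoef L2_derive// (_ : (hermite_fun k)^`()%classic =
  fun x => lower k * hermite_fun k.-1 x + (- lower k.+1) * hermite_fun k.+1 x).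
  by rewrite L2C L2_lincomb// !(L2C f); ring.
by apply/funext => x; rewrite derive_hermite mulNr.
Qed.

Lemma A_adjE (c d : R) f : schwartz f -> A_adj (fun x => c * x + d) f =
  (fun x => -1 * (fun y => (c * y + d) * f y)^`()%classic x + 0 * f x).
Proof. by move=> sf; apply/funext => x; rewrite mul0r addr0 mulN1r. Qed.

Lemma schwartz_A_adj (c d : R) f : schwartz f -> schwartz (A_adj (fun x => c * x + d) f).
Proof.
move=> sf; rewrite A_adjE//; apply: schwartz_lincomb => //.
exact/schwartz_derive/schwartz_affine.
Qed.

(** The diagonal entries come from
c * (lower k ^ 2 - lower (k+1) ^ 2) = - c/2. *)
Lemma hcoef_A_adj (c d : R) f k : schwartz f ->
  hcoef (A_adj (fun x => c * x + d) f) k = adj_coef c d (hcoef f) k.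
Proof.
move=> sf; have sa := schwartz_affine c d sf.
have aff j : hcoef (fun x => (c * x + d) * f x) j =
    c * hcoef (fun x => x * f x) j + d * hcoef f j.
  rewrite -hcoef_lincomb//; last exact: schwartz_X.
  by congr hcoef; apply/funext => x; ring.
rewrite A_adjE// hcoef_lincomb//; last exact: schwartz_derive.
rewrite hcoef_derive// !aff !hcoef_X// /adj_coef /adj_skew /ladder /lower2.
rewrite !addn2 !addn1 subn1 subn2 /=.
have s1 := sqr_lower (R := R) k.+1; have s0 := sqr_lower (R := R) k.
(* The identity k.-1.+1 = k fails at k = 0, where lower 0 = 0. *)
have E : lower k * (lower k.-1.+1 * hcoef f k.-1.+1) = lower k ^+ 2 * hcoef f k.
  by case: k {s0 s1} => [|k]; [rewrite lower0 expr2 !mul0r|rewrite expr2 mulrA].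
apply/eqP; rewrite -subr_eq0; apply/eqP.
transitivity (c * (lower k * (lower k.-1.+1 * hcoef f k.-1.+1))
  - c * lower k.+1 ^+ 2 * hcoef f k + c / 2 * hcoef f k).
  by field.
by rewrite E s0 s1 -(nat1r k); field.
Qed.

(** With sigma' = c, one has sigma (sigma phi)' = (sigma^2 phi)' - c sigma phi, hence
A* A* phi = (sigma^2 phi)'' + c A* phi. *)
Lemma L_adjE (c d c' d' : R) f : schwartz f ->
  L_adj (fun x => c * x + d) (fun x => c' * x + d') f =
  (fun x => 1 * (2^-1 * A_adj (fun x => c * x + d) (A_adj (fun x => c * x + d) f) x
    + - (c / 2) * A_adj (fun x => c * x + d) f x)
    + 1 * A_adj (fun x => c' * x + d') f x).
Proof.
move=> sf; pose psi := fun x => (c * x + d) * f x.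
have sp : schwartz psi by exact: schwartz_affine.
have sdp := schwartz_derive sp; have sxdp := schwartz_affine c d sdp.
have Epsi : (fun y => (c * y + d) ^+ 2 * f y) = (fun y => (c * y + d) * psi y).
  by apply/funext => y; rewrite /psi; ring.
have Epsi1 : (fun y => (c * y + d) * psi y)^`()%classic =
    (fun y => c * psi y + 1 * ((c * y + d) * psi^`()%classic y)).
  by apply/funext => y; rewrite derive_affineM// mul1r.
have EA : A_adj (fun x => c * x + d) f = (fun x => -1 * psi^`()%classic x + 0 * f x).
  by rewrite A_adjE.
have EAA : A_adj (fun x => c * x + d) (A_adj (fun x => c * x + d) f) =
    (fun x => ((fun y => (c * y + d) * psi^`()%classic y)^`())%classic x).
  apply/funext => x; rewrite [LHS]/A_adj EA.
  have -> : (fun y => (c * y + d) * (-1 * psi^`()%classic y + 0 * f y)) =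
     (fun y => -1 * ((c * y + d) * psi^`()%classic y) + 0 * f y).
    by apply/funext => y; ring.
  by rewrite derive_lincomb//; ring.
apply/funext => x; rewrite EAA EA [LHS]/L_adj Epsi derive1nS derive1n1 Epsi1.
rewrite derive_lincomb// derive_affineM//.
by rewrite /A_adj; field.
Qed.

Lemma hcoef_L_adj (c d c' d' : R) f k : schwartz f ->
  hcoef (L_adj (fun x => c * x + d) (fun x => c' * x + d') f) k =
  2^-1 * adj_coef c d (adj_coef c d (hcoef f)) k
  - c / 2 * adj_coef c d (hcoef f) k + adj_coef c' d' (hcoef f) k.
Proof.
move=> sf; have sA := schwartz_A_adj c d sf.
have sAA := schwartz_A_adj c d sA; have sB := schwartz_A_adj c' d' sf.
rewrite L_adjE// hcoef_lincomb//; last exact: schwartz_lincomb.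
rewrite hcoef_lincomb// !hcoef_A_adj// mulNr !mul1r; congr (_ * _ - _ + _).
by congr adj_coef; apply/funext => j; exact: hcoef_A_adj.
Qed.

(** Since x - d/dx and x + d/dx are adjoint to each other and exchange h_k and
h_(k+1) up to the same factor, all h_k have the same norm. *)
Lemma L2_hermite_diag k : L2_inner (@hermite_fun R k) (hermite_fun k) =
  L2_inner (@hermite_fun R 0) (hermite_fun 0).
Proof.
elim: k => [//|k <-]; have sh j := @schwartz_hermite R j.
pose f := fun x => 1 * (x * @hermite_fun R k.+1 x) + 1 * (hermite_fun k.+1)^`()%classic x.
have l0 : 2 * lower k.+1 != 0 :> R.
  by rewrite mulf_neq0// gt_eqF// sqrtr_gt0 divr_gt0// ltr0n.
have h1 : hcoef f k = 2 * lower k.+1 * L2_inner (@hermite_fun R k.+1) (hermite_fun k.+1).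
  rewrite hcoef_lincomb ?hcoef_X ?hcoef_derive//; first by rewrite /hcoef; ring.
    exact: schwartz_X.
  exact: schwartz_derive.
have h2 : hcoef f k = 2 * lower k.+1 * L2_inner (@hermite_fun R k) (hermite_fun k).
  rewrite (_ : f = fun x => 2 * lower k.+1 * hermite_fun k x + 0 * hermite_fun k x).
    by rewrite hcoef_lincomb// mul0r addr0.
  by apply/funext => x; rewrite /f hermite_X derive_hermite/=; ring.
by apply: (mulfI l0); rewrite -h1 h2.
Qed.

(** By |f h_k| <= f^2 + h_k^2 under the integral. *)
Lemma hcoef_bounded f : schwartz f -> exists M : R, forall k, `|hcoef f k| <= M.
Proof.
move=> sf; exists (L2_inner f f + L2_inner (@hermite_fun R 0) (hermite_fun 0)) => k.
rewrite -(L2_hermite_diag k); have sh := @schwartz_hermite R k.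
apply: le_trans (le_normr_Rintegral _ (schwartz_integrable sf sh)) _ => //.
have iff := schwartz_integrable sf sf; have ihh := schwartz_integrable sh sh.
rewrite -RintegralD//; apply: le_Rintegral => //.
- by apply: integrable_norm; exact: schwartz_integrable.
- exact: (integrableD measurableT iff ihh).
- by move=> x _; rewrite ler_norml; apply/andP; split; nra.
Qed.

(** The Hermite function h_k is an eigenfunction of the harmonic oscillator
x^2 - d^2/dx^2, which is symmetric. *)
Lemma hcoef_oscillator f k : schwartz f ->
  hcoef (fun x => 1 * (x * (x * f x)) + -1 * (f^`())^`()%classic x) k =
  (2 * k%:R + 1) * hcoef f k.
Proof.
move=> sf; have sx := schwartz_X sf; have sd := schwartz_derive sf.
rewrite hcoef_lincomb; [|exact: schwartz_X|exact: schwartz_derive].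
rewrite !hcoef_X// !hcoef_derive//=.
have s1 := sqr_lower (R := R) k.+1; have s0 := sqr_lower (R := R) k.
have E : lower k * (lower k.-1.+1 * hcoef f k.-1.+1) = lower k ^+ 2 * hcoef f k.
  by case: k {s0 s1} => [|k]; [rewrite lower0 expr2 !mul0r|rewrite expr2 mulrA].
transitivity (2 * (lower k * (lower k.-1.+1 * hcoef f k.-1.+1)) + 2 * lower k.+1 ^+ 2 * hcoef f k).
  by ring.
by rewrite E s0 s1 -(nat1r k); field.
Qed.

(** Iterating the oscillator trades powers of 2k+1 for Schwartz functions, whose
coefficients are bounded. *)
Lemma rapid_hcoef f : schwartz f -> rapid (hcoef f).
Proof.
move=> sf N; elim: N f sf => [|N IH] f sf.
  have [M HM] := hcoef_bounded sf; exists M => k; rewrite expr0 mulr1; exact: HM.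
have sx := schwartz_X sf; have sd := schwartz_derive sf.
have sH := schwartz_lincomb 1 (-1) (schwartz_X sx) (schwartz_derive sd).
have [M HM] := IH _ sH; exists M => k.
apply: le_trans (HM k); rewrite hcoef_oscillator// normrM exprS mulrA.
rewrite ler_wpM2r ?exprn_ge0// mulrC ler_wpM2r//.
have k0 : 0 <= k%:R :> R by exact: ler0n.
by rewrite ger0_norm -?(nat1r k); lra.
Qed.

End HermiteCoefficients.

(** * The monotonicity inequality *)

Theorem theorem1p2 (R : realType) (alpha beta gamma delta : R) :
  let sigma := fun x : R => alpha * x + beta in
  let b := fun x : R => gamma * x + delta in
  forall p : R, exists2 C : R, 0 < C &
    forall phi : R -> R, schwartz phi ->
      2 * hs_inner p phi (L_adj sigma b phi) + hs_norm p (A_adj sigma phi) ^+ 2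
        <= C * hs_norm p phi ^+ 2.
Proof.
move=> sigma b p; set w := fun k : nat => (2 * k + 1)%:R `^ (2 * p).
have ws : symbol_weight w by exact: symbol_weight_pow.
have hsE f g : hs_inner p f g = sums (fun k => w k * hcoef f k * hcoef g k) by [].
have hs_normE f : schwartz f -> hs_norm p f ^+ 2 = wnorm2 w (hcoef f).
  move=> sf; have rf := rapid_hcoef sf.
  have E : hs_inner p f f = wnorm2 w (hcoef f).
    by rewrite hsE; congr sums; apply/funext => k; rewrite expr2 mulrA.
  by rewrite /hs_norm E sqr_sqrtr// wnorm2_ge0.
have [C HC] := tame_adj_form ws alpha beta gamma delta.
exists (`|C| + 1) => [|phi sphi]; first by rewrite ltr_wpDl.
have ra := rapid_hcoef sphi; have [rF bF] := HC _ ra.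
have sA := schwartz_A_adj alpha beta sphi.
have Aa : hcoef (A_adj sigma phi) = adj_coef alpha beta (hcoef phi).
  by apply/funext => k; rewrite hcoef_A_adj.
have rA := rapid_hcoef sA.
have tw := weight_tempered ws.
have rwa : rapid (fun k => w k * hcoef phi k) by exact: rapidM_tempered.
rewrite !hs_normE// hsE /wnorm2.
have La : hcoef (L_adj sigma b phi) = fun k =>
    2^-1 * adj_coef alpha beta (adj_coef alpha beta (hcoef phi)) k
    - alpha / 2 * adj_coef alpha beta (hcoef phi) k
    + adj_coef gamma delta (hcoef phi) k.
  by apply/funext => k; rewrite hcoef_L_adj.
have rL : rapid (fun k => w k * hcoef phi k * hcoef (L_adj sigma b phi) k).
  apply: rapidM => //.
  have sB := schwartz_A_adj gamma delta sphi.
  have sAA := schwartz_A_adj alpha beta sA.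
  rewrite /sigma /b L_adjE//; apply: rapid_hcoef.
  by apply: schwartz_lincomb => //; exact: schwartz_lincomb.
rewrite -sumsZ// -sumsD; last 2 first.
- exact: rapidZ.
- exact: rapid_wnorm2.
rewrite Aa La; apply: le_trans (ler_norm _) _; apply: le_trans bF _.
have n0 : 0 <= wnorm2 w (hcoef phi) by exact: wnorm2_ge0.
by rewrite -/(wnorm2 w _) ler_wpM2r//; have := ler_norm C; lra.
Qed.
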